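(* $\mathbb{H}\times\mathbb{R}^2_3$ is not a convex subset of a normed space with the canonical convexity structure. That is, with $d$ and $W$ the product metric and product convexity mapping on $\mathbb{H}\times\mathbb{R}^2_3$, there do not exist a real normed space $(E,\|\cdot\|)$, a convex subset $C\subseteq E$ and a bijection $f:\mathbb{H}\times\mathbb{R}^2_3\to C$ such that, for all $a,b\in\mathbb{H}\times\mathbb{R}^2_3$ and $\lambda\in[0,1]$, $\|f(a)-f(b)\|=d(a,b)$ and $f(W(a,b,\lambda))=(1-\lambda)f(a)+\lambda f(b)$.
   Context: $\mathbb{H}:=\{(x_1,x_2)\in\mathbb{R}^2\mid x_2>0\}$ is the Poincaré upper half-plane with metric $d_{\mathbb{H}}(x,y):=\operatorname{arcosh}\left(1+\frac{(y_1-x_1)^2+(y_2-x_2)^2}{2x_2y_2}\right)$, where $\operatorname{arcosh}t=\ln(t+\sqrt{t^2-1})$ for $t\ge1$. For any $x,y\in\mathbb{H}$ there is a unique geodesic from $x$ to $y$, i.e. a unique $\gamma:[0,1]\to\mathbb{H}$ with $\gamma(0)=x$, $\gamma(1)=y$ and $d_{\mathbb{H}}(\gamma(t),\gamma(t'))=|t-t'|d_{\mathbb{H}}(x,y)$ for all $t,t'\in[0,1]$; put $W_{\mathbb{H}}(x,y,\lambda):=\gamma(\lambda)$. In particular the midpoint is $W_{\mathbb{H}}(x,y,\tfrac12)=\left(\frac{x_1y_2+x_2y_1}{x_2+y_2},\frac{\sqrt{x_2y_2}\sqrt{(x_2+y_2)^2+(x_1-y_1)^2}}{x_2+y_2}\right)$.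 $\mathbb{R}^2_3$ is the plane $\mathbb{R}^2$ with the norm $\|(s,t)\|_3=(|s|^3+|t|^3)^{1/3}$, and $W_3(p,q,\lambda)=(1-\lambda)p+\lambda q$. On $\mathbb{H}\times\mathbb{R}^2_3$: $d((x,p),(y,q)):=\left((d_{\mathbb{H}}(x,y))^2+\|p-q\|_3^2\right)^{1/2}$ and $W((x,p),(y,q),\lambda):=(W_{\mathbb{H}}(x,y,\lambda),W_3(p,q,\lambda))$. *)

(* Defs.v *)
From HB Require Import structures.
From mathcomp Require Import all_boot all_order all_algebra.
From mathcomp Require Import all_classical all_reals all_analysis.
Set Implicit Arguments.
Unset Strict Implicit.
Unset Printing Implicit Defensive.
Import Order.TTheory GRing.Theory Num.Theory.
Import numFieldNormedType.Exports.
Local Open Scope classical_set_scope.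
Local Open Scope ring_scope.

Definition arcosh (R : realType) (t : R) : R := ln (t + Num.sqrt (t ^+ 2 - 1)).

Definition halfplane (R : realType) : Type := {x : R * R | 0 < x.2}.

Definition halfplane_dist (R : realType) (x y : halfplane R) : R :=
  let: (x1, x2) := sval x in
  let: (y1, y2) := sval y in
  arcosh (1 + ((y1 - x1) ^+ 2 + (y2 - x2) ^+ 2) / (2 * x2 * y2)).

(* [{i01 R}] is the type of the elements of the closed interval [0, 1]. *)
Definition halfplane_geodesic (R : realType) (x y : halfplane R)
    (g : {i01 R} -> halfplane R) : Prop :=
  [/\ g 0%:i01 = x, g 1%:i01 = y &
      forall s t : {i01 R},
        halfplane_dist (g s) (g t) = `|s%:num - t%:num| * halfplane_dist x y].

(* There is exactly one geodesic from x to y, so the default value of [xget]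
   (the constant map) is never used. *)
Definition halfplane_conv (R : realType) (x y : halfplane R) (l : {i01 R}) :
    halfplane R :=
  xget (fun=> x) [set g | halfplane_geodesic x y g] l.

(* The library norm of the product [R * R] is the max norm, hence the explicit
   norm and metric below. *)
Definition norm3 (R : realType) (p : R * R) : R :=
  (`|p.1| ^+ 3 + `|p.2| ^+ 3) `^ 3^-1.

Definition plane_conv (R : realType) (p q : R * R) (l : {i01 R}) : R * R :=
  ((1 - l%:num) * p.1 + l%:num * q.1, (1 - l%:num) * p.2 + l%:num * q.2).

Definition prod_space (R : realType) : Type := (halfplane R * (R * R))%type.

Definition prod_dist (R : realType) (a b : prod_space R) : R :=
  Num.sqrt (halfplane_dist a.1 b.1 ^+ 2 + norm3 (a.2 - b.2) ^+ 2).

Definition prod_conv (R : realType) (a b : prod_space R) (l : {i01 R}) :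
    prod_space R :=
  (halfplane_conv a.1 b.1 l, plane_conv a.2 b.2 l).

(* Main.v *)
Require Import Defs.
From HB Require Import structures.
From mathcomp Require Import all_boot all_order all_algebra.
From mathcomp Require Import all_classical all_reals all_analysis.
From mathcomp Require Import ring lra.
Set Implicit Arguments.
Unset Strict Implicit.
Unset Printing Implicit Defensive.
Import Order.TTheory GRing.Theory Num.Theory.
Import numFieldNormedType.Exports.
Local Open Scope classical_set_scope.
Local Open Scope ring_scope.

(** In a normed space the segment joining the midpoints of two sides of a
    triangle has exactly half the length of the third side; in the hyperbolic
    plane it is strictly shorter.  The slice [p = 0] of the product is an
    isometric copy of the hyperbolic plane, and an isometry [f] that respects
    the convexity mappings makes [W (x, y, 1/2)] a metric midpoint of [x] and
    [y] because its image is the midpoint of a segment of [E]; hence nothing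
    about geodesics has to be known.

    One right isosceles triangle suffices: [x = (0, 1)], [y = (0, 4)],
    [z = (15/17, 8/17)], whose sides at [x] both have hyperbolic cosine 17/8.
    The metric midpoints of these two sides are unique, namely [(0, 2)] and
    [(3/5, 4/5)].  The distance between them has hyperbolic cosine 25/16, so
    its double has hyperbolic cosine [2 * (25/16)^2 - 1 = 497/128], whereas
    the one of [d(y, z)] is [(17/8)^2 = 578/128].  The distances are
    compared through the duplication formula [arcosh_half]. *)

(** The hyperbolic cosine of the distance in the half-plane. *)
Definition cosh_dist (R : realType) (x y : R * R) : R :=
  1 + ((y.1 - x.1) ^+ 2 + (y.2 - x.2) ^+ 2) / (2 * x.2 * y.2).

Lemma halfplane_distE (R : realType) (x y : halfplane R) :
  halfplane_dist x y = arcosh (cosh_dist (sval x) (sval y)).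
Proof. by case: x y => [[x1 x2] x0] [[y1 y2] y0]. Qed.

Lemma cosh_dist_ge1 (R : realType) (x y : halfplane R) :
  1 <= cosh_dist (sval x) (sval y).
Proof.
case: x y => [[x1 x2] /= x0] [[y1 y2] /= y0]; rewrite /cosh_dist /= lerDl.
by rewrite divr_ge0 ?addr_ge0 ?sqr_ge0// !mulr_ge0// ltW.
Qed.

Lemma arcosh_ge0 (R : realType) (t : R) : 1 <= t -> 0 <= arcosh t.
Proof. by move=> t1; rewrite ln_ge0// ler_wpDr// sqrtr_ge0. Qed.

Lemma halfplane_dist_ge0 (R : realType) (x y : halfplane R) :
  0 <= halfplane_dist x y.
Proof. by rewrite halfplane_distE arcosh_ge0// cosh_dist_ge1. Qed.

Lemma arcosh_inj (R : realType) (s t : R) :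
  1 <= s -> 1 <= t -> arcosh s = arcosh t -> s = t.
Proof.
move=> s1 t1.
have pos (u : R) : 1 <= u -> u + Num.sqrt (u ^+ 2 - 1) \is Num.pos.
  by move=> u1; rewrite posrE ltr_wpDr ?sqrtr_ge0// (lt_le_trans _ u1).
move=> /(ln_inj (pos _ s1) (pos _ t1)) st.
have mono (u v : R) : 1 <= u -> u < v ->
    u + Num.sqrt (u ^+ 2 - 1) < v + Num.sqrt (v ^+ 2 - 1).
  move=> u1 uv; rewrite ltr_leD// ler_wsqrtr// lerB// ler_sqr ?nnegrE; lra.
by case: (ltgtP s t) => // /mono lt; have := lt ltac:(done); rewrite st ltxx.
Qed.

Lemma arcosh_double (R : realType) (s : R) :
  1 <= s -> arcosh (2 * s ^+ 2 - 1) = 2 * arcosh s.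
Proof.
move=> s1; have s21 : 0 <= s ^+ 2 - 1 by nra.
have q0 := sqrtr_ge0 (s ^+ 2 - 1); have q2 := sqr_sqrtr s21.
rewrite /arcosh [RHS]mulr_natl -lnXn; last by lra.
congr ln; set q := Num.sqrt (s ^+ 2 - 1) in q0 q2 *.
have -> : (2 * s ^+ 2 - 1) ^+ 2 - 1 = (2 * s * q) ^+ 2.
  by rewrite exprMn q2; ring.
rewrite sqrtr_sqr ger0_norm ?mulr_ge0//; last by lra.
by rewrite sqrrD q2; ring.
Qed.

Lemma arcosh_half (R : realType) (s t : R) :
  1 <= s -> 1 <= t -> arcosh s = 2^-1 * arcosh t -> t = 2 * s ^+ 2 - 1.
Proof.
move=> s1 t1 st; apply: arcosh_inj => //; first by nra.
by rewrite arcosh_double// st mulrA divff ?mul1r// pnatr_eq0.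
Qed.

Lemma halfplane_dist_half (R : realType) (x y u v : halfplane R) :
  halfplane_dist x y = 2^-1 * halfplane_dist u v ->
  cosh_dist (sval u) (sval v) = 2 * cosh_dist (sval x) (sval y) ^+ 2 - 1.
Proof. by rewrite !halfplane_distE; apply: arcosh_half; exact: cosh_dist_ge1. Qed.

(** The points at a given distance from [x] form a Euclidean circle. *)
Lemma cosh_distP (R : realType) (x y : R * R) (c : R) :
    0 < x.2 -> 0 < y.2 -> cosh_dist x y = c ->
  (y.1 - x.1) ^+ 2 + (y.2 - x.2) ^+ 2 = (c - 1) * (2 * x.2 * y.2).
Proof.
move=> x0 y0 <-; rewrite /cosh_dist addrAC subrr add0r divfK//.
by rewrite !mulf_neq0 ?pnatr_eq0 ?gt_eqF.
Qed.

(** No isometry of the half-plane into a normed space has an image stable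
    under midpoints; [mid x y] is the point sent to the midpoint of [g x] and
    [g y], which makes it a metric midpoint of [x] and [y]. *)
Lemma halfplane_not_normed (R : realType) (E : normedModType R)
    (g : halfplane R -> E) (mid : halfplane R -> halfplane R -> halfplane R) :
  (forall x y, `|g x - g y| = halfplane_dist x y) ->
  (forall x y, g (mid x y) = 2^-1 *: g x + 2^-1 *: g y) ->
  False.
Proof.
move=> g_isom g_mid.
have half v : v = 2^-1 *: v + 2^-1 *: v :> E.
  by rewrite -scalerDl -div1r -splitr scale1r.
have normhalf (v : E) : `|2^-1 *: v| = 2^-1 * `|v|.
  by rewrite normrZ ger0_norm// invr_ge0.
have mid_l x y : halfplane_dist x (mid x y) = 2^-1 * halfplane_dist x y.
  rewrite -!g_isom g_mid {1}(half (g x)) -normhalf scalerBr.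
  by rewrite opprD addrACA subrr add0r.
have mid_r x y : halfplane_dist (mid x y) y = 2^-1 * halfplane_dist x y.
  rewrite -!g_isom g_mid {2}(half (g y)) -normhalf scalerBr.
  by rewrite opprD addrACA subrr addr0.
have mid_mid x y z :
    halfplane_dist (mid x y) (mid x z) = 2^-1 * halfplane_dist y z.
  rewrite -!g_isom !g_mid -normhalf scalerBr.
  by rewrite opprD addrACA subrr add0r.
have x0 : 0 < (0 : R, 1 : R).2 by [].
have y0 : 0 < (0 : R, 4 : R).2 by rewrite /=; lra.
have z0 : 0 < (15 / 17 : R, 8 / 17 : R).2 by rewrite /=; lra.
pose x : halfplane R := exist (fun u => is_true (0 < u.2)) _ x0.
pose y : halfplane R := exist (fun u => is_true (0 < u.2)) _ y0.
pose z : halfplane R := exist (fun u => is_true (0 < u.2)) _ z0.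
have xy : cosh_dist (sval x) (sval y) = 17 / 8 by rewrite /cosh_dist /=; field.
have xz : cosh_dist (sval x) (sval z) = 17 / 8 by rewrite /cosh_dist /=; field.
have yz : cosh_dist (sval y) (sval z) = 289 / 64.
  by rewrite /cosh_dist /=; field.
(* 5/4 is the solution [c >= 1] of [17/8 = 2 * c^2 - 1]. *)
have half_cosh (u v : halfplane R) :
    17 / 8 = 2 * cosh_dist (sval u) (sval v) ^+ 2 - 1 ->
    cosh_dist (sval u) (sval v) = 5 / 4.
  by have := cosh_dist_ge1 u v; set c := cosh_dist _ _ => c1 ?; nra.
have := halfplane_dist_half (mid_l x y); rewrite xy => /half_cosh xm.
have := halfplane_dist_half (mid_r x y); rewrite xy => /half_cosh my.
have := halfplane_dist_half (mid_l x z); rewrite xz => /half_cosh xn.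
have := halfplane_dist_half (mid_r x z); rewrite xz => /half_cosh nz.
have := halfplane_dist_half (mid_mid x y z); rewrite yz.
case: (mid x y) (mid x z) xm my xn nz => [[m1 m2] /= m0] [[n1 n2] /= n0].
move=> /cosh_distP /= => /(_ x0 m0) xm /cosh_distP /= => /(_ m0 y0) my.
move=> /cosh_distP /= => /(_ x0 n0) xn /cosh_distP /= => /(_ n0 z0) nz.
have m2E : m2 = 2 by lra.
have m1E : m1 = 0.
  by apply/eqP; rewrite -sqrf_eq0; apply/eqP; rewrite m2E in xm; lra.
(* The difference of the two equations for the midpoint is linear; the first
   one then becomes a perfect square. *)
have n1E : n1 = 3 / 4 * n2 by lra.
have n2E : n2 = 4 / 5.
  have : (5 / 4 * n2 - 1) ^+ 2 = 0 by rewrite n1E in xn; lra.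
  by move=> /eqP; rewrite sqrf_eq0 => /eqP; lra.
have -> : cosh_dist (m1, m2) (n1, n2) = 25 / 16.
  by rewrite /cosh_dist /= n1E n2E m1E m2E; field.
lra.
Qed.

Lemma prod_dist_slice (R : realType) (x y : halfplane R) :
  prod_dist (x, (0, 0)) (y, (0, 0)) = halfplane_dist x y.
Proof.
rewrite /prod_dist /norm3 /= subrr normr0 expr0n addr0.
rewrite powR0 ?invr_eq0 ?pnatr_eq0// expr0n addr0.
by rewrite sqrtr_sqr ger0_norm// halfplane_dist_ge0.
Qed.

Lemma prod_conv_slice (R : realType) (x y : halfplane R) (l : {i01 R}) :
  prod_conv (x, (0, 0)) (y, (0, 0)) l = (halfplane_conv x y l, (0, 0)).
Proof. by rewrite /prod_conv /plane_conv /= !mulr0 addr0. Qed.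

Theorem corollary4p4 (R : realType) :
  ~ exists (E : normedModType R) (C : set E) (f : prod_space R -> E),
      [/\ convex_set C,
          set_bij [set: prod_space R] C f,
          forall a b : prod_space R, `|f a - f b| = prod_dist a b &
          forall (a b : prod_space R) (l : {i01 R}),
            f (prod_conv a b l) = (1 - l%:num) *: f a + l%:num *: f b].
Proof.
case=> E [C [f [_ _ f_isom f_conv]]].
have h0 : 0 <= 2^-1 :> R by rewrite invr_ge0.
have h1 : 2^-1 <= 1 :> R by rewrite invf_le1// ler1n.
pose h : {i01 R} := Itv01 h0 h1.
have isom (x y : halfplane R) : `|f (x, (0, 0)) - f (y, (0, 0))| = halfplane_dist x y.
  by rewrite f_isom prod_dist_slice.
have mid (x y : halfplane R) : f (halfplane_conv x y h, (0, 0)) =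
    2^-1 *: f (x, (0, 0)) + 2^-1 *: f (y, (0, 0)).
  rewrite -prod_conv_slice f_conv /=.
  by have -> : 1 - 2^-1 = 2^-1 :> R by field.
exact: (halfplane_not_normed isom mid).
Qed.
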